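(* Let $q$ be a prime power, $r\ge 2$ an integer, and $u$ a positive integer with $u \mid \frac{q^r-1}{q-1}$. Let $\mathcal{X}_u=\{P_1,\dots,P_n\}$ be the set of rational points of the extended norm-trace curve over $\mathbb{F}_{q^r}$, let $\mathcal{M}\subseteq\Delta\left(x^{(q-1)u+1},y^{q^{r-1}}\right)$ be a set of monomials closed under divisibility, and let $\mathrm{ev}(\mathcal{M})$ be the corresponding decreasing norm-trace code. Then the dual code $\mathrm{ev}(\mathcal{M})^\perp$ is equivalent to the code $\mathrm{ev}(\mathcal{M}^\complement)$, where $$\mathcal{M}^\complement:=\left\{\frac{x^{(q-1)u}y^{q^{r-1}-1}}{x^iy^j} : x^iy^j\in\Delta\left(x^{(q-1)u+1},y^{q^{r-1}}\right)\setminus\mathcal{M}\right\}.$$ More precisely, $$\mathrm{ev}(\mathcal{M})^\perp=\boldsymbol{\beta}\cdot\mathrm{ev}(\mathcal{M}^\complement),$$ where $\boldsymbol{\beta}=(\beta_1,\dots,\beta_n)$ with $\beta_i:=u^{-1}$ if the $x$-coordinate of $P_i$ is nonzero, and $\beta_i:=1$ otherwise.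
   Context: Let $Tr(y)=y^{q^{r-1}}+y^{q^{r-2}}+\cdots+y^q+y$. The set of rational points of the (affine) extended norm-trace curve is $\mathcal{X}_u=\{(\alpha,\beta)\in\mathbb{F}_{q^r}^2:\alpha^u=Tr(\beta)\}$. The evaluation map is $\mathrm{ev}:\mathbb{F}_{q^r}[x,y]\to\mathbb{F}_{q^r}^n$, $f\mapsto(f(P_1),\dots,f(P_n))$. A set $\mathcal{M}$ of monomials in $x,y$ is closed under divisibility if $M\in\mathcal{M}$ and $M'\mid M$ imply $M'\in\mathcal{M}$. For a set $\mathcal{M}$ of monomials, $\mathrm{ev}(\mathcal{M})$ denotes the image under $\mathrm{ev}$ of the $\mathbb{F}_{q^r}$-span of $\mathcal{M}$; it is called a decreasing norm-trace code when $\mathcal{M}$ is closed under divisibility. $\Delta(x^i,y^j)$ denotes the set of monomials in $x,y$ that are multiples of neither $x^i$ nor $y^j$. The dual $C^\perp$ of a linear code $C\subseteq\mathbb{F}_{q^r}^n$ is taken with respect to the standard (Euclidean) bilinear form. For $\boldsymbol{\beta}\in\mathbb{F}_{q^r}^n$ and a code $C$, $\boldsymbol{\beta}\cdot C=\{(\beta_1c_1,\dots,\beta_nc_n):(c_1,\dots,c_n)\in C\}$; codes $C_1,C_2$ are equivalent if $C_2=\boldsymbol{\beta}\cdot C_1$ for some $\boldsymbol{\beta}$ with all $\beta_i\ne0$. The integer $u$ is viewed as an element of $\mathbb{F}_q$ (it is nonzero there, since $u\mid\frac{q^r-1}{q-1}$ is coprime to the characteristic). *)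

(* Defs.v *)
From HB Require Import structures.
From mathcomp Require Export all_boot all_order all_algebra.
From mathcomp Require Export boolp classical_sets.
From mathcomp Require Export mpoly.

Set Implicit Arguments.
Unset Strict Implicit.
Unset Printing Implicit Defensive.

Import GRing.Theory.
Local Open Scope classical_set_scope.
Local Open Scope ring_scope.

Definition prime_power (q : nat) : Prop :=
  exists p k : nat, [/\ prime p, (0 < k)%N & q = (p ^ k)%N].

Definition Tr (F : finFieldType) (q r : nat) (y : F) : F :=
  \sum_(i < r) y ^+ (q ^ i)%N.

Definition norm_trace_points (F : finFieldType) (q r u : nat) : set (F * F) :=
  [set P | P.1 ^+ u = Tr q r P.2].

(* Monomials in x, y are exponent vectors in 'X_{1..2}: x is the variable of
   index 0, y the one of index 1, and (m' <= m)%MM is divisibility m' | m. *)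
Definition xymon (i j : nat) : 'X_{1..2} := [multinom of [:: i; j]].

Definition divisibility_closed (M : set 'X_{1..2}) : Prop :=
  forall m m' : 'X_{1..2}, M m -> (m' <= m)%MM -> M m'.

Definition Delta (a b : nat) : set 'X_{1..2} :=
  [set m | ~~ (xymon a 0 <= m)%MM && ~~ (xymon 0 b <= m)%MM].

(* The difference of exponent vectors is truncated, but here it is only applied
   to divisors of x^((q-1)u) y^(q^(r-1)-1), where it is the exact quotient. *)
Definition complement_monomials (q r u : nat) (M : set 'X_{1..2}) :
    set 'X_{1..2} :=
  [set (xymon ((q - 1) * u) (q ^ (r - 1) - 1) - m)%MM
    | m in Delta ((q - 1) * u + 1) (q ^ (r - 1)) `\` M].

Definition ev (F : finFieldType) (n : nat) (P : n.-tuple (F * F))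
    (f : {mpoly F[2]}) : 'rV[F]_n :=
  \row_(i < n) f.@[tnth [tuple (tnth P i).1; (tnth P i).2]].

Definition monomial_span (F : finFieldType) (M : set 'X_{1..2}) :
    set {mpoly F[2]} :=
  [set f | forall m : 'X_{1..2}, m \in msupp f -> M m].
Arguments monomial_span F M : clear implicits.

Definition ev_code (F : finFieldType) (n : nat) (P : n.-tuple (F * F))
    (M : set 'X_{1..2}) : set 'rV[F]_n :=
  ev P @` monomial_span F M.

Definition dual_code (F : finFieldType) (n : nat) (C : set 'rV[F]_n) :
    set 'rV[F]_n :=
  [set v | forall c : 'rV[F]_n, C c -> \sum_(i < n) v 0 i * c 0 i = 0].

Definition scale_code (F : finFieldType) (n : nat) (b : 'rV[F]_n)
    (C : set 'rV[F]_n) : set 'rV[F]_n :=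
  [set (\row_(i < n) (b 0 i * c 0 i) : 'rV[F]_n) | c in C].

Definition equivalent_codes (F : finFieldType) (n : nat)
    (C1 C2 : set 'rV[F]_n) : Prop :=
  exists b : 'rV[F]_n, (forall i, b 0 i != 0) /\ C2 = scale_code b C1.

Definition norm_trace_beta (F : finFieldType) (n u : nat)
    (P : n.-tuple (F * F)) : 'rV[F]_n :=
  \row_(i < n) (if (tnth P i).1 != 0 then u%:R^-1 else 1).

(* Main.v *)
(* Put A = (q-1)u, N = q^(r-1), g = X^(A+1) - X and f_c = Tr(Y) - c.  The points
   of the curve are the pairs (x, y) with g(x) = 0 and f_c(y) = 0 for c = x^u;
   both polynomials divide X^|F| - X, so they split with simple roots.  Lagrange
   interpolation gives \sum_z h(z) / p'(z) = (coefficient of X^(deg p - 1) in h)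
   over the roots z of such a p when deg h < deg p.  Here f_c' = 1, and the
   weight beta is exactly -1/g' on the roots of g.  Hence the beta-weighted sum
   of x^s y^t over the curve vanishes when t < N - 1, or when s < A and
   t <= 2(N - 1), and is -1 when (s, t) = (A, N - 1).  The beta-pairing of the
   monomials of the box with their complements is therefore triangular for
   divisibility with diagonal -1.  As ev maps the span of the box onto the
   whole space, this determines the dual. *)
Require Import Defs.
From mathcomp Require Import finfield.
From mathcomp Require Import ring zify.

Set Implicit Arguments.
Unset Strict Implicit.
Unset Printing Implicit Defensive.

Import GRing.Theory.
Local Open Scope ring_scope.

(** * Monomials in two variables and their values at points *)

Lemma ord2_cases (i : 'I_2) : i = ord0 \/ i = ord_max.
Proof. by case: i => [[|[|]]] // ?; [left|right]; apply: val_inj. Qed.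

Lemma xymon0 i j : xymon i j ord0 = i. Proof. by []. Qed.

Lemma xymon1 i j : xymon i j ord_max = j. Proof. by []. Qed.

Lemma xymon_le (i j : nat) (m : 'X_{1..2}) :
  (xymon i j <= m)%MM = (i <= m ord0)%N && (j <= m ord_max)%N.
Proof.
apply/mnm_lepP/andP => [le_m | [le0 le1] k]; first by split; apply: le_m.
by have [->|->] := ord2_cases k.
Qed.

Lemma le_xymon (i j : nat) (m : 'X_{1..2}) :
  (m <= xymon i j)%MM = (m ord0 <= i)%N && (m ord_max <= j)%N.
Proof.
apply/mnm_lepP/andP => [le_m | [le0 le1] k].
  by split; [apply: (le_m ord0) | apply: (le_m ord_max)].
by have [->|->] := ord2_cases k.
Qed.

Lemma ev_monomial (F : finFieldType) (n : nat) (P : n.-tuple (F * F))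
    (m : 'X_{1..2}) (i : 'I_n) :
  ev P 'X_[m] 0 i = (tnth P i).1 ^+ m ord0 * (tnth P i).2 ^+ m ord_max.
Proof.
rewrite mxE mevalX !big_ord_recl big_ord0 mulr1.
by have -> : lift ord0 ord0 = ord_max :> 'I_2 by apply: val_inj.
Qed.

(** Turns the box into the divisors of a single monomial, the form in which taking complements is
    division into that monomial. *)
Lemma Delta_le (a b : nat) (m : 'X_{1..2}) :
  Delta a.+1 b.+1 m <-> (m <= xymon a b)%MM.
Proof.
by rewrite /Delta /= !xymon_le le_xymon /= andbT -!ltnNge !ltnS.
Qed.

(** * Lagrange interpolation and weighted sums over roots *)

Lemma deriv_prod_XsubC_root (F : idomainType) (rs : seq F) (z : F) :
    uniq rs -> z \in rs ->
  (\prod_(w <- rs) ('X - w%:P))^`().[z] =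
    \prod_(w <- rs | w != z) (z - w).
Proof.
move=> rs_uniq z_rs; rewrite (bigD1_seq z) //= derivM derivXsubC mul1r !hornerE.
rewrite subrr mul0r addr0 horner_prod.
by apply: eq_bigr => w _; rewrite !hornerE.
Qed.

(* The coefficient of top degree of the Lagrange interpolation formula. *)
Lemma sum_horner_div_deriv (F : fieldType) (rs : seq F) (h : {poly F}) :
    uniq rs -> (size h <= size rs)%N ->
  \sum_(z <- rs) h.[z] / (\prod_(w <- rs) ('X - w%:P))^`().[z] =
    h`_(size rs).-1.
Proof.
move=> rs_uniq size_h; set f := \prod_(w <- rs) _.
pose Q z := \prod_(w <- rs | w != z) ('X - w%:P).
have QE z : z \in rs -> size (Q z) = size rs /\ (Q z)`_(size rs).-1 = 1.
  move=> z_rs.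
  have size_Q : size (Q z) = size rs.
    rewrite /Q -big_filter size_prod_XsubC.
    rewrite -(rem_filter z rs_uniq) size_rem // prednK //.
    by case: (rs) z_rs.
  split=> //; rewrite -[X in X.-1]size_Q -[LHS]/(lead_coef (Q z)).
  by rewrite /Q lead_coef_prod_XsubC.
have Qz z : z \in rs -> (Q z).[z] = f^`().[z].
  move=> z_rs; rewrite deriv_prod_XsubC_root // horner_prod.
  by apply: eq_bigr => w _; rewrite !hornerE.
have f'_neq0 z : z \in rs -> f^`().[z] != 0.
  move=> z_rs; rewrite deriv_prod_XsubC_root //.
  by rewrite prodf_seq_neq0; apply/allP => w _; rewrite subr_eq0 eq_sym implybb.
(* [p] is [h] minus its interpolant: it vanishes at every entry of [rs] and has degree below their
   number, so it is zero. *)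
pose p := h - \sum_(z <- rs) (h.[z] / f^`().[z]) *: Q z.
suff p0 : p = 0.
  rewrite [in RHS](subr0_eq p0) coef_sum; apply: eq_big_seq => z z_rs.
  by rewrite coefZ (QE z z_rs).2 mulr1.
apply: (@roots_geq_poly_eq0 _ p rs) => //.
  apply/allP => x x_rs; rewrite /root /p hornerD hornerN horner_sum.
  rewrite (bigD1_seq x) //= big1_seq => [|z /andP[zx z_rs]]; last first.
    rewrite hornerZ [(Q z).[x]](_ : _ = 0) ?mulr0 //; apply/eqP.
    rewrite horner_prod prodf_seq_eq0; apply/hasP; exists x => //.
    by rewrite eq_sym zx !hornerE subrr eqxx.
  by rewrite hornerZ Qz // divfK ?f'_neq0 // addr0 subrr.
rewrite /p (leq_trans (size_polyD _ _)) // geq_max size_h size_polyN.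
apply: leq_trans (size_sum _ _ _) _; apply/bigmax_leqP_seq => z z_rs _.
by rewrite (leq_trans (size_scale_leq _ _)) // (QE z z_rs).1.
Qed.

(** Since X^|F| - X is the product of X - z over all z in F, a divisor is, up to a unit, the product
    over a subsequence of the elements. Being monic removes the unit, and the subsequence can only
    list the roots, each once. *)
Lemma dvdp_genPoly_split (F : finFieldType) (f : {poly F}) :
  f \is monic -> f %| 'X^#|F| - 'X ->
  f = \prod_(z <- enum (root f)) ('X - z%:P).
Proof.
move=> f_monic; rewrite finField_genPoly -big_enum /=.
move=> /(@dvdp_prod_XsubC _ _ _ id)[m].
rewrite eqp_monic ?monic_prod_XsubC // => /eqP fE.
have in_mask z : (z \in mask m (enum F)) = root f z.
  by rewrite fE root_prod_XsubC.
rewrite [LHS]fE; apply: perm_big; apply: uniq_perm; rewrite ?enum_uniq //.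
  by rewrite mask_uniq // enum_uniq.
by move=> z; rewrite in_mask mem_enum.
Qed.

(** Interpolation at all the roots of [f]. As [size f] is the degree plus one, [(size f).-2] is the
    index deg f - 1. *)
Lemma sum_root_div_deriv (F : finFieldType) (f h : {poly F}) :
    f \is monic -> f %| 'X^#|F| - 'X -> (size h < size f)%N ->
  \sum_(z | root f z) h.[z] / f^`().[z] = h`_(size f).-2.
Proof.
move=> f_monic f_dvd; have fE := dvdp_genPoly_split f_monic f_dvd.
have sfE : size f = (size (enum (root f))).+1 by rewrite {1}fE size_prod_XsubC.
rewrite sfE ltnS => size_h.
by rewrite -(sum_horner_div_deriv (enum_uniq _) size_h) -fE [RHS]big_enum.
Qed.

(** * The trace polynomial and power sums over its fibers *)

(** Raising to the power [q] is additive and shifts the summands by one, so the difference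
    telescopes. *)
Lemma trace_Frobenius (R : comNzRingType) (q r : nat) (x : R) :
    [pchar R].-nat q ->
  (\sum_(i < r) x ^+ (q ^ i)%N) ^+ q - \sum_(i < r) x ^+ (q ^ i)%N =
    x ^+ (q ^ r)%N - x.
Proof.
move=> pchar_q; have /andP[q_gt0 _] := pchar_q; elim: r => [|r IHr].
  by rewrite !big_ord0 expr0n gtn_eqF // expn0 expr1 !subrr.
rewrite !big_ord_recr /= exprDn_pchar // -exprM -expnSr.
by rewrite opprD addrACA IHr addrC subrKA.
Qed.

(** If [q] were nonzero in F it would be coprime to the characteristic, hence to itself, forcing q =
    1. *)
Lemma pchar_natr_eq0 (F : idomainType) (q : nat) :
  [pchar F].-nat q -> (1 < q)%N -> q%:R = 0 :> F.
Proof.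
move=> pchar_q q_gt1; apply/eqP; rewrite -[_ == 0]negbK -pcharf'_nat.
apply/negP => /(pnat_coprime pchar_q); rewrite /coprime gcdnn => /eqP q1.
by rewrite q1 in q_gt1.
Qed.

Definition trace_poly (F : finFieldType) (q r : nat) : {poly F} :=
  \sum_(i < r) 'X^(q ^ i)%N.

Lemma horner_trace_poly (F : finFieldType) (q r : nat) (y : F) :
  (trace_poly F q r).[y] = Tr q r y.
Proof. by rewrite horner_sum; apply: eq_bigr => i _; rewrite hornerXn. Qed.

Lemma deriv_trace_poly (F : finFieldType) (q r : nat) :
  q%:R = 0 :> F -> (trace_poly F q r.+1)^`() = 1.
Proof.
move=> q0; rewrite raddf_sum big_ord_recl /= derivXn expn0 expr0 big1 ?addr0 //.
by move=> i _; rewrite derivXn expnS -mulr_natl natrM -(polyC_natr _ q) q0 !mul0r.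
Qed.

Lemma size_trace_poly_tail (F : finFieldType) (q r : nat) :
  (1 < q)%N -> (size (trace_poly F q r) <= q ^ r)%N.
Proof.
move=> q_gt1; apply: leq_trans (size_sum _ _ _) _; apply/bigmax_leqP => i _.
by rewrite size_polyXn ltn_exp2l.
Qed.

Lemma trace_poly_shape (F : finFieldType) (q r : nat) (c : F) :
    (1 < q)%N ->
  trace_poly F q r.+1 - c%:P \is monic /\
  size (trace_poly F q r.+1 - c%:P) = (q ^ r).+1.
Proof.
move=> q_gt1; have q_gt0 := ltnW q_gt1.
have size_tail : (size (trace_poly F q r - c%:P)%R < size ('X^(q ^ r) : {poly F}))%N.
  rewrite size_polyXn ltnS (leq_trans (size_polyD _ _)) // geq_max size_polyN.
  rewrite size_trace_poly_tail // (leq_trans (size_polyC_leq1 _)) //.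
  by rewrite expn_gt0 q_gt0.
rewrite /trace_poly big_ord_recr /= addrAC addrC; split.
  by rewrite monicE lead_coefDl // lead_coefXn.
by rewrite size_polyDl // size_polyXn.
Qed.

(** With T the trace polynomial, X^(q^r) - X = T^q - T. As c^q = c, this is also (T - c)^q - (T -
    c), a multiple of T - c. *)
Lemma trace_poly_dvd (F : finFieldType) (q r : nat) (c : F) :
    [pchar F].-nat q -> c ^+ q = c ->
  trace_poly F q r - c%:P %| 'X^(q ^ r) - 'X.
Proof.
move=> pchar_q cq.
have pchar_poly : [pchar {poly F}].-nat q.
  apply: sub_in_pnat pchar_q => p _; exact: (rmorph_pchar polyC).
rewrite -(trace_Frobenius _ _ pchar_poly) -/(trace_poly F q r).
set T := trace_poly F q r.
have -> : T ^+ q - T = (T - c%:P) ^+ q - (T - c%:P).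
  have := exprDn_pchar (T - c%:P) c%:P pchar_poly.
  rewrite subrK -polyC_exp cq => ->; ring.
by have /andP[q_gt0 _] := pchar_q; rewrite dvdp_sub // dvdp_exp.
Qed.

(** The derivative of the trace polynomial minus c is 1, so the interpolation weights disappear and
    the sum is the coefficient of X^(q^r - 1) in X^t. *)
Lemma sum_trace_fiber (F : finFieldType) (q r t : nat) (c : F) :
    [pchar F].-nat q -> (1 < q)%N -> #|F| = (q ^ r.+1)%N ->
    c ^+ q = c -> (t < q ^ r)%N ->
  \sum_(y | Tr q r.+1 y == c) y ^+ t = (t == (q ^ r).-1)%:R.
Proof.
move=> pchar_q q_gt1 cardF cq t_lt.
have [f_monic size_f] := trace_poly_shape r c q_gt1.
have := trace_poly_dvd r.+1 pchar_q cq; rewrite -cardF => f_dvd.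
have q0 : q%:R = 0 :> F by exact: pchar_natr_eq0.
have := sum_root_div_deriv (h := 'X^t) f_monic f_dvd.
rewrite size_f size_polyXn ltnS => /(_ t_lt).
rewrite coefXn eq_sym => <-; apply: eq_big => y.
  by rewrite /root !hornerE horner_trace_poly subr_eq0.
by rewrite derivB derivC subr0 deriv_trace_poly // !hornerE divr1.
Qed.

(* In the range [q ^ r <= t] the relation [y ^+ q ^ r = c - \sum_(i < r) ..]
   lowers the exponent; the term in [c] it produces is a power sum that
   vanishes. *)
Lemma sum_trace_fiber_const (F : finFieldType) (q r t : nat) (c : F) :
    [pchar F].-nat q -> (1 < q)%N -> #|F| = (q ^ r.+1)%N ->
    c ^+ q = c -> (t <= (q ^ r).-1.*2)%N ->
  \sum_(y | Tr q r.+1 y == c) y ^+ t =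
    \sum_(y | Tr q r.+1 y == 0 :> F) y ^+ t.
Proof.
move=> pchar_q q_gt1 cardF cq.
have q_gt0 := ltnW q_gt1; have N_gt0 : (0 < q ^ r)%N by rewrite expn_gt0 q_gt0.
have zq : 0 ^+ q = 0 :> F by rewrite expr0n gtn_eqF.
elim/ltn_ind: t => t IHt t_le; have [t_lt | N_le] := ltnP t (q ^ r).
  by rewrite !sum_trace_fiber.
have [k tE] : exists k, t = (q ^ r + k)%N by exists (t - q ^ r)%N; rewrite subnKC.
have step (d : F) : d ^+ q = d -> \sum_(y | Tr q r.+1 y == d) y ^+ t =
    - \sum_(i < r) \sum_(y | Tr q r.+1 y == d) y ^+ (q ^ i + k).
  move=> dq.
  have k_lt : (k < q ^ r)%N by lia.
  (* The bound on [t] gives k <= q^r - 2, just below the one exponent less than q^r whose power sum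
     is nonzero. *)
  have Sk : \sum_(y | Tr q r.+1 y == d) y ^+ k = 0.
    by rewrite sum_trace_fiber // ltn_eqF //; lia.
  rewrite exchange_big /= -sumrN -[RHS]add0r.
  rewrite -[X in X + _](mulr0 d) -[X in d * X]Sk mulr_sumr -big_split /=.
  apply: eq_bigr => y /eqP; rewrite /Tr big_ord_recr /= => <-.
  rewrite tE exprD mulrDl -addrA addrCA; under [X in _ - X]eq_bigr do rewrite exprD.
  by rewrite -mulr_suml subrr addr0.
rewrite !step //; congr (- _); apply: eq_bigr => i _.
have qi_lt : (q ^ i < q ^ r)%N by rewrite ltn_exp2l.
by apply: IHt; lia.
Qed.

(** * The polynomial of the x-coordinates and its weights *)

Lemma XnsubX_shape (F : fieldType) (A : nat) : (0 < A)%N ->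
  ('X^(A.+1) - 'X : {poly F}) \is monic /\
  size ('X^(A.+1) - 'X : {poly F}) = A.+2.
Proof.
move=> A_gt0; have size_X : (size (- 'X : {poly F}) < size ('X^(A.+1) : {poly F}))%N.
  by rewrite size_polyN size_polyX size_polyXn !ltnS.
by rewrite monicE lead_coefDl // lead_coefXn size_polyDl // size_polyXn eqxx.
Qed.

Lemma XnsubX_dvd (F : fieldType) (A k : nat) :
  ('X^(A.+1) - 'X : {poly F}) %| 'X^((A * k).+1) - 'X.
Proof.
rewrite !exprS -[X in _ - X]mulr1 -[X in _ %| _ - X]mulr1 -!mulrBr.
by rewrite dvdp_mul2l ?polyX_eq0 // exprM [X in _ %| X]subrX1 dvdp_mulr.
Qed.

Lemma root_XnsubX (F : fieldType) (A : nat) (x : F) :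
  root ('X^(A.+1) - 'X) x = (x ^+ A.+1 == x).
Proof. by rewrite /root !hornerE subr_eq0. Qed.

(** In F the leading factor (q-1)u + 1 equals 1 - u. A nonzero root satisfies x^((q-1)u) = 1, which
    gives (1 - u) - 1 = -u; at x = 0 only the -1 coming from -X remains. *)
Lemma deriv_XnsubX_root (F : fieldType) (q u : nat) (x : F) :
    (1 < q)%N -> (0 < u)%N -> q%:R = 0 :> F -> x ^+ ((q - 1) * u).+1 = x ->
  ('X^(((q - 1) * u).+1) - 'X)^`().[x] = - (if x != 0 then u%:R else 1).
Proof.
move=> q_gt1 u_gt0 q0 xA; rewrite derivB derivXn derivX !hornerE /=.
rewrite hornerMn hornerXn -mulr_natl.
have -> : (((q - 1) * u).+1)%:R = 1 - u%:R :> F.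
  by rewrite -natr1 natrM natrB ?(ltnW q_gt1) // q0 sub0r mulN1r addrC.
have [x0 | x_neq0] := eqVneq x 0.
  by rewrite x0 expr0n gtn_eqF ?muln_gt0 ?subn_gt0 ?q_gt1 // mulr0 sub0r.
have -> : x ^+ ((q - 1) * u) = 1.
  by apply: (mulfI x_neq0); rewrite -exprS xA mulr1.
by ring.
Qed.

Lemma sum_beta_expr (F : finFieldType) (q u k s : nat) :
    (1 < q)%N -> (0 < u)%N -> q%:R = 0 :> F ->
    #|F| = ((q - 1) * u * k).+1 -> (s <= (q - 1) * u)%N ->
  \sum_(x : F | x ^+ ((q - 1) * u).+1 == x)
    (if x != 0 then u%:R^-1 else 1) * x ^+ s = - (s == ((q - 1) * u)%N)%:R.
Proof.
move=> q_gt1 u_gt0 q0 cardF s_le; set A := ((q - 1) * u)%N in s_le *.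
have A_gt0 : (0 < A)%N by rewrite muln_gt0 subn_gt0 q_gt1.
have [g_monic size_g] := XnsubX_shape F A_gt0.
have := XnsubX_dvd F A k; rewrite -cardF => g_dvd.
have := sum_root_div_deriv (h := 'X^s) g_monic g_dvd.
rewrite size_g size_polyXn !ltnS => /(_ s_le) /=.
rewrite coefXn eq_sym => <-; rewrite -sumrN; apply: eq_big => x.
  by rewrite root_XnsubX.
move=> /eqP xA; rewrite deriv_XnsubX_root // hornerXn.
by rewrite invrN mulrN opprK mulrC; case: ifP => _; rewrite ?invr1.
Qed.

(** * Fibering the curve over x, and the weighted pairing *)

(** A trace is fixed by the power [q], hence so is x^u; for x nonzero, cancelling x^u in x^(uq) =
    x^u leaves x^((q-1)u) = 1. *)
Lemma norm_trace_point_root (F : finFieldType) (q r u : nat) (x y : F) :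
    [pchar F].-nat q -> #|F| = (q ^ r)%N -> x ^+ u = Tr q r y ->
  x ^+ ((q - 1) * u).+1 = x.
Proof.
move=> pchar_q cardF xu; have /andP[q_gt0 _] := pchar_q.
have [-> | x_neq0] := eqVneq x 0; first by rewrite expr0n.
have : (x ^+ u) ^+ q = x ^+ u.
  apply/eqP; rewrite xu -subr_eq0 /Tr trace_Frobenius // -cardF.
  by rewrite expf_card subrr.
rewrite -exprM -[in LHS](subnK q_gt0) mulnDr muln1 exprD => xE.
rewrite exprS mulnC -[RHS]mulr1; congr (_ * _).
by apply: (mulIf (expf_neq0 u x_neq0)); rewrite mul1r.
Qed.

(** Makes c = x^u an admissible constant for the fiber sums, which require c^q = c. *)
Lemma root_expr_Frobenius (F : fieldType) (q u : nat) (x : F) :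
  (0 < q)%N -> (0 < u)%N ->
  x ^+ ((q - 1) * u).+1 = x -> (x ^+ u) ^+ q = x ^+ u.
Proof.
case: u => // u q_gt0 _ xA; rewrite -exprM.
(* The exponent splits off (q-1)u + 1 for the original [u], so no division by x occurs and x = 0 is
   covered. *)
have -> : (u.+1 * q = ((q - 1) * u.+1).+1 + u)%N by nia.
by rewrite exprD xA -exprS.
Qed.

Lemma sum_norm_trace_points (F : finFieldType) (q r u n : nat)
    (P : n.-tuple (F * F)) (phi : F -> F -> F) :
    [pchar F].-nat q -> #|F| = (q ^ r)%N -> uniq P ->
    (forall p : F * F, p \in P <-> norm_trace_points q r u p) ->
  \sum_(i < n) phi (tnth P i).1 (tnth P i).2 =
  \sum_(x | x ^+ ((q - 1) * u).+1 == x) \sum_(y | Tr q r y == x ^+ u) phi x y.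
Proof.
move=> pchar_q cardF P_uniq PE.
rewrite -(big_tuple _ _ P xpredT (fun p => phi p.1 p.2)) big_uniq //=.
rewrite pair_big_dep /=; apply: eq_bigl => -[x y] /=.
apply/idP/andP => [/PE /= xy | [_ /eqP xy]]; last by apply/PE.
by rewrite xy eqxx (norm_trace_point_root pchar_q cardF xy) eqxx.
Qed.

Section NormTracePairing.
Variables (F : finFieldType) (q r u k n : nat) (P : n.-tuple (F * F)).
Hypotheses (pchar_q : [pchar F].-nat q) (q_gt1 : (1 < q)%N) (u_gt0 : (0 < u)%N).
Hypotheses (cardF : #|F| = (q ^ r.+1)%N) (cardFk : #|F| = ((q - 1) * u * k).+1).
Hypotheses (P_uniq : uniq P)
  (PE : forall p : F * F, p \in P <-> norm_trace_points q r.+1 u p).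

Let b (x : F) : F := if x != 0 then u%:R^-1 else 1.

Let pairing s t : F := \sum_(i < n)
  norm_trace_beta u P 0 i * ((tnth P i).1 ^+ s * (tnth P i).2 ^+ t).

Let pairingE s t : pairing s t =
  \sum_(x | x ^+ ((q - 1) * u).+1 == x)
    b x * x ^+ s * \sum_(y | Tr q r.+1 y == x ^+ u) y ^+ t.
Proof.
rewrite /pairing; under eq_bigr do rewrite mxE -/(b _) mulrA.
rewrite (sum_norm_trace_points (u := u)
  (fun x y => b x * x ^+ s * y ^+ t) pchar_q cardF) //.
by under eq_bigr do rewrite -mulr_sumr.
Qed.

Let expr_u_Frobenius x : x ^+ ((q - 1) * u).+1 == x -> (x ^+ u) ^+ q = x ^+ u :> F.
Proof. by move/eqP; apply: root_expr_Frobenius; rewrite // ltnW. Qed.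

(** The inner sum over y already vanishes on each fiber. *)
Lemma pairing_low s t : (t < (q ^ r).-1)%N -> pairing s t = 0.
Proof.
move=> t_lt; rewrite pairingE big1 // => x /expr_u_Frobenius xu.
by rewrite sum_trace_fiber ?ltn_eqF ?mulr0 //; lia.
Qed.

(** In this range the inner sum over y is the same for every x, so the double sum factors and the
    x-factor is [sum_beta_expr]. *)
Lemma pairing_high s t : (s <= (q - 1) * u)%N -> (t <= (q ^ r).-1.*2)%N ->
  pairing s t =
    - (s == ((q - 1) * u)%N)%:R * \sum_(y | Tr q r.+1 y == 0 :> F) y ^+ t.
Proof.
move=> s_le t_le; rewrite pairingE.
have q0 : q%:R = 0 :> F by exact: pchar_natr_eq0.
rewrite -(sum_beta_expr q_gt1 u_gt0 q0 cardFk s_le) mulr_suml.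
by apply: eq_bigr => x /expr_u_Frobenius xu; rewrite (sum_trace_fiber_const pchar_q).
Qed.

Lemma pairing_top : pairing ((q - 1) * u) (q ^ r).-1 = -1.
Proof.
have N_gt0 : (0 < q ^ r)%N by rewrite expn_gt0 ltnW.
have zq : 0 ^+ q = 0 :> F by rewrite expr0n gtn_eqF // ltnW.
rewrite pairing_high ?eqxx //; last by lia.
by rewrite sum_trace_fiber ?eqxx ?mulr1 // prednK.
Qed.

End NormTracePairing.

(** * Spans of monomials and surjectivity of evaluation on the box *)

Lemma monomial_span0 (F : finFieldType) (M : set 'X_{1..2}) :
  monomial_span F M 0.
Proof. by move=> m; rewrite msupp0. Qed.

Lemma monomial_spanD (F : finFieldType) (M : set 'X_{1..2}) (f g : {mpoly F[2]}) :
  monomial_span F M f -> monomial_span F M g -> monomial_span F M (f + g).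
Proof.
by move=> Mf Mg m /msuppD_le; rewrite mem_cat => /orP[/Mf | /Mg].
Qed.

Lemma monomial_spanZ (F : finFieldType) (M : set 'X_{1..2}) (c : F)
    (f : {mpoly F[2]}) :
  monomial_span F M f -> monomial_span F M (c *: f).
Proof. by move=> Mf m /msuppZ_le /Mf. Qed.

Lemma monomial_span_sum (F : finFieldType) (M : set 'X_{1..2}) (I : Type)
    (s : seq I) (Q : pred I) (f : I -> {mpoly F[2]}) :
  (forall i, Q i -> monomial_span F M (f i)) ->
  monomial_span F M (\sum_(i <- s | Q i) f i).
Proof.
move=> Mf; elim/big_rec: _ => [|i g Qi Mg]; first exact: monomial_span0.
by apply: monomial_spanD; [apply: Mf|].
Qed.

Lemma monomial_spanX (F : finFieldType) (M : set 'X_{1..2}) (m : 'X_{1..2}) :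
  M m -> monomial_span F M 'X_[m].
Proof. by move=> Mm m'; rewrite msuppX mem_seq1 => /eqP ->. Qed.

Lemma ev_sum (F : finFieldType) (n : nat) (P : n.-tuple (F * F)) (I : Type)
    (s : seq I) (Q : pred I) (f : I -> {mpoly F[2]}) :
  ev P (\sum_(i <- s | Q i) f i) = \sum_(i <- s | Q i) ev P (f i).
Proof.
apply/rowP => j; rewrite summxE mxE raddf_sum.
by apply: eq_bigr => i _; rewrite mxE.
Qed.

Lemma evZ (F : finFieldType) (n : nat) (P : n.-tuple (F * F)) (c : F)
    (f : {mpoly F[2]}) : ev P (c *: f) = c *: ev P f.
Proof. by apply/rowP => j; rewrite !mxE mevalZ. Qed.

Lemma ev_separated (F : finFieldType) (n : nat) (P : n.-tuple (F * F))
    (a b : nat) (f g : {poly F}) :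
    (size f <= a.+1)%N -> (size g <= b.+1)%N ->
  exists2 h, monomial_span F [set m | (m <= xymon a b)%MM]%classic h &
    forall i, ev P h 0 i = f.[(tnth P i).1] * g.[(tnth P i).2].
Proof.
move=> size_f size_g.
exists (\sum_(i < a.+1) \sum_(j < b.+1) (f`_i * g`_j) *: 'X_[xymon i j]).
  do 2!apply: monomial_span_sum => ? _.
  by apply: monomial_spanZ; apply: monomial_spanX; rewrite /= le_xymon /= !leq_ord.
move=> i; rewrite (horner_coef_wide _ size_f) (horner_coef_wide _ size_g).
rewrite ev_sum summxE mulr_suml; apply: eq_bigr => k _.
rewrite ev_sum summxE mulr_sumr; apply: eq_bigr => l _.
by rewrite evZ mxE ev_monomial mulrACA.
Qed.

(** The quotient of [p] by X - x vanishes at the other roots and takes the value p'(x) at x; it is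
    normalized by that value. *)
Lemma root_indicator (F : fieldType) (p : {poly F}) (x : F) :
    root p x -> p^`().[x] != 0 ->
  exists2 h : {poly F}, (size h <= (size p).-1)%N &
    forall y, root p y -> h.[y] = (y == x)%:R.
Proof.
move=> px p'x; have /factor_theorem[h pE] := px.
have h_neq0 : h != 0.
  by apply: contra_neq p'x => h0; rewrite pE h0 mul0r derivC hornerC.
have hx : h.[x] = p^`().[x].
  by rewrite pE derivM derivXsubC !hornerE subrr mulr0 add0r.
rewrite -hx in p'x; exists (h.[x]^-1 *: h) => [|y].
  rewrite size_scale ?invr_eq0 // pE size_Mmonic ?monicXsubC // size_XsubC.
  by rewrite addnS addn1.
rewrite pE rootM root_XsubC hornerZ; have [-> _ | _] := eqVneq y x.
  by rewrite mulVf.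
by rewrite orbF => /eqP ->; rewrite mulr0.
Qed.

(** The indicator of a point is a product of an indicator in x and one in y, whose degrees fit the
    box. *)
Lemma ev_surjective (F : finFieldType) (q r u k n : nat) (P : n.-tuple (F * F)) :
    [pchar F].-nat q -> (1 < q)%N -> (0 < u)%N -> u%:R != 0 :> F ->
    #|F| = (q ^ r.+1)%N -> #|F| = ((q - 1) * u * k).+1 -> uniq P ->
    (forall p : F * F, p \in P <-> norm_trace_points q r.+1 u p) ->
  forall v : 'rV[F]_n,
    ev_code P [set m | (m <= xymon ((q - 1) * u) (q ^ r).-1)%MM]%classic v.
Proof.
move=> pchar_q q_gt1 u_gt0 u_neq0 cardF cardFk P_uniq PE v.
set box := [set m | _]%classic.
have q0 : q%:R = 0 :> F by exact: pchar_natr_eq0.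
have A_gt0 : (0 < (q - 1) * u)%N by rewrite muln_gt0 subn_gt0 q_gt1.
have on_curve j : (tnth P j).1 ^+ u = Tr q r.+1 (tnth P j).2.
  by have /PE := mem_tnth j P.
have x_root j : (tnth P j).1 ^+ ((q - 1) * u).+1 = (tnth P j).1.
  exact: norm_trace_point_root pchar_q cardF (on_curve j).
have indicator i : exists2 h, monomial_span F box h & ev P h = delta_mx 0 i.
  set x := (tnth P i).1; set y := (tnth P i).2.
  have [_ size_f] := XnsubX_shape F A_gt0.
  have [_ size_g] := trace_poly_shape r (Tr q r.+1 y) q_gt1.
  have [||f size_f' fE] := @root_indicator _ ('X^(((q - 1) * u).+1) - 'X) x.
  - by rewrite root_XnsubX x_root.
  - rewrite deriv_XnsubX_root ?x_root // oppr_eq0.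
    by case: ifP => // _; exact: oner_neq0.
  have [||g size_g' gE] :=
    @root_indicator _ (trace_poly F q r.+1 - (Tr q r.+1 y)%:P) y.
  - by rewrite /root !hornerE horner_trace_poly subrr.
  - by rewrite derivB derivC subr0 deriv_trace_poly // hornerC oner_neq0.
  rewrite size_f in size_f'; rewrite size_g in size_g'.
  have N_gt0 : (0 < q ^ r)%N by rewrite expn_gt0 ltnW.
  have [//||h box_h hE] := @ev_separated F n P ((q - 1) * u) (q ^ r).-1 f g.
    by rewrite prednK.
  exists h => //; apply/rowP => j.
  rewrite hE !mxE eqxx /= fE ?root_XnsubX ?x_root //.
  (* The y-factor is controlled only on the roots of Tr - Tr(y). This suffices: when the
     x-coordinates differ the x-factor is zero, and when they agree the curve equation makes the
     traces equal. *)
  have [xE | xj] := eqVneq (tnth P j).1 x; last first.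
    by rewrite mul0r; have [ji | //] := eqVneq j i; rewrite ji eqxx in xj.
  rewrite mul1r gE; last first.
    by rewrite /root !hornerE horner_trace_poly -!on_curve xE subrr.
  have [yE | yj] := eqVneq (tnth P j).2 y; last first.
    by have [ji | //] := eqVneq j i; rewrite ji eqxx in yj.
  suff -> : j = i by rewrite eqxx.
  apply: (tuple_uniqP _ P_uniq).
  by rewrite [LHS]surjective_pairing xE yE -surjective_pairing.
pose h i := s2val (cid2 (indicator i)).
exists (\sum_i v 0 i *: h i).
  apply: monomial_span_sum => i _; apply: monomial_spanZ.
  exact: (s2valP (cid2 _)).
rewrite ev_sum [RHS]row_sum_delta; apply: eq_bigr => i _.
by rewrite evZ (s2valP' (cid2 (indicator i))).
Qed.

(** * Duality deduced from a triangular pairing of monomials *)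

Section TriangularDuality.
Variables (F : finFieldType) (n : nat) (P : n.-tuple (F * F)) (b : 'rV[F]_n).
Variables (top : 'X_{1..2}) (M : set 'X_{1..2}).

Definition monomial_pairing (m k : 'X_{1..2}) : F :=
  \sum_(i < n) b 0 i * (ev P 'X_[m] 0 i * ev P 'X_[k] 0 i).

Lemma ev_pairingE (f g : {mpoly F[2]}) :
  \sum_(i < n) b 0 i * ev P g 0 i * ev P f 0 i =
    \sum_(m <- msupp f) f@_m *
      \sum_(k <- msupp g) g@_k * monomial_pairing m k.
Proof.
have evE h i : ev P h 0 i = \sum_(m <- msupp h) h@_m * ev P 'X_[m] 0 i.
  rewrite {1}(mpolyE h) ev_sum summxE; apply: eq_bigr => m _.
  by rewrite evZ mxE.
under eq_bigr do rewrite (evE f) mulr_sumr.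
rewrite exchange_big; apply: eq_bigr => m _ /=; rewrite mulr_sumr.
under eq_bigr do rewrite (evE g) mulr_sumr mulr_suml.
rewrite exchange_big; apply: eq_bigr => k _ /=; rewrite 2!mulr_sumr.
by apply: eq_bigr => i _; ring.
Qed.

Hypotheses (M_box : forall m, M m -> (m <= top)%MM)
  (M_closed : divisibility_closed M).
Hypotheses
  (pairing_eq0 : forall m k, (m <= top)%MM -> (k <= top)%MM -> ~~ (k <= m)%MM ->
     monomial_pairing m (top - k)%MM = 0)
  (pairing_neq0 : forall m, (m <= top)%MM -> monomial_pairing m (top - m)%MM != 0).
Hypotheses (b_neq0 : forall i, b 0 i != 0)
  (ev_surj : forall v, ev_code P [set m | (m <= top)%MM]%classic v).

Let subtopK m : (m <= top)%MM -> (top - (top - m))%MM = m.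
Proof. by move=> m_le; rewrite submBA // addmC addmK. Qed.

Let complement : set 'X_{1..2} :=
  [set (top - m)%MM | m in [set m | (m <= top)%MM] `\` M]%classic.

(* The pairing matrix is triangular for divisibility, so the coefficients of
   [g] at the complements of monomials of [M] vanish by induction on the degree. *)
Lemma orthogonal_coef_eq0 (g : {mpoly F[2]}) :
    monomial_span F [set m | (m <= top)%MM]%classic g ->
    (forall m, M m -> \sum_(k <- msupp g) g@_k * monomial_pairing m k = 0) ->
  forall m, M m -> g@_(top - m) = 0.
Proof.
move=> g_box g_orth m; have [d] := ubnP (mdeg m); elim: d m => // d IHd m m_lt Mm.
have [m_supp | /memN_msupp_eq0 //] := boolP ((top - m)%MM \in msupp g).
(* The diagonal pairing is nonzero, so it is enough that its product with the coefficient vanish;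
   that product is the only surviving term in the orthogonality relation of [m]. *)
apply/eqP; rewrite -(mulIr_eq0 _ (mulIf (pairing_neq0 (M_box Mm)))).
apply/eqP; rewrite -[RHS](g_orth m Mm) (bigD1_seq _ m_supp) //= big1_seq ?addr0 //.
move=> k /andP[k_neq /g_box /= k_le]; rewrite -(subtopK k_le).
have tk_le : (top - k <= top)%MM by exact: lem_subr.
(* When [top - k] does not divide [m] the pairing is zero. Otherwise it is a proper divisor of [m],
   so it lies in [M] and has smaller degree. *)
have [tk_m | tk_m] := boolP (top - k <= m)%MM; last first.
  by rewrite pairing_eq0 ?mulr0 // M_box.
rewrite IHd ?mul0r //; last exact: M_closed Mm tk_m.
suff : (mdeg (top - k) < mdeg m)%N by lia.
rewrite -[in ltnRHS](submK tk_m) mdegD -[X in (X < _)%N]add0n.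
rewrite ltn_add2r lt0n mdeg_eq0.
apply: contra k_neq => /eqP mk0.
have := submK tk_m; rewrite mk0 add0m => <-.
by rewrite subtopK.
Qed.

(** Complements are orthogonal to [M] because a monomial outside [M] divides none in [M], by
    closure. Conversely, a dual vector lifts to a polynomial on the box, whose coefficients at
    complements of [M] vanish by triangularity. *)
Lemma dual_ev_code : dual_code (ev_code P M) = scale_code b (ev_code P complement).
Proof.
apply/seteqP; split=> [v v_dual | _ [_ [g g_span <-] <-] _ [f f_span <-]].
  (* Dividing [v] by the nowhere zero [b] before lifting exhibits [v] as a scaled evaluation. *)
  have [g g_box gE] := ev_surj (\row_i (v 0 i / b 0 i)).
  have vE i : v 0 i = b 0 i * ev P g 0 i by rewrite gE mxE mulrC divfK.
  exists (ev P g); last by apply/rowP => i; rewrite mxE -vE.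
  exists g => // m m_supp; have m_le := g_box m m_supp.
  exists (top - m)%MM; last exact: subtopK.
  split=> [|Mm]; first exact: lem_subr.
  move: m_supp; rewrite mcoeff_msupp -(subtopK m_le).
  rewrite (orthogonal_coef_eq0 g_box _ Mm) ?eqxx // => k Mk.
  have := v_dual (ev P 'X_[k]); under eq_bigr do rewrite vE.
  rewrite ev_pairingE msuppX big_seq1 mcoeffX eqxx mul1r; apply.
  by exists 'X_[k] => //; apply: monomial_spanX.
under eq_bigr do rewrite mxE.
rewrite ev_pairingE big1_seq // => m /andP[_ /f_span Mm].
rewrite big1_seq ?mulr0 // => _ /andP[_ /g_span[k [k_le Mk] <-]].
rewrite (pairing_eq0 (M_box Mm) k_le) ?mulr0 //.
by apply/negP => km; apply: Mk; apply: M_closed km.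
Qed.

End TriangularDuality.

(** * Application to the norm-trace curve *)

Theorem theorem5p1 (F : finFieldType) (q r u : nat)
    (hq : prime_power q) (hr : (2 <= r)%N) (hF : #|F| = (q ^ r)%N)
    (hu0 : (0 < u)%N) (hu : (u %| (q ^ r - 1) %/ (q - 1))%N)
    (n : nat) (P : n.-tuple (F * F)) (hPuniq : uniq P)
    (hP : forall p : F * F, p \in P <-> norm_trace_points q r u p)
    (M : set 'X_{1..2})
    (hMsub : (M `<=` Delta ((q - 1) * u + 1) (q ^ (r - 1)))%classic)
    (hM : divisibility_closed M) :
  equivalent_codes (dual_code (ev_code P M))
                   (ev_code P (complement_monomials q r u M)) /\
  dual_code (ev_code P M) =
    scale_code (norm_trace_beta u P)
               (ev_code P (complement_monomials q r u M)).
Proof.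
(* From here on [r] denotes the original exponent minus one, so the field has [q ^ r.+1] elements
   and the box has y-degree below [q ^ r]. *)
case: r hr hF hu hP hMsub => // r _ cardF u_dvd PE.
rewrite /complement_monomials (subn1 r.+1) (subn1 (q ^ _)) addn1 [r.+1.-1]/=.
set A := ((q - 1) * u)%N; move=> M_sub.
have [p [e [p_pr e_gt0 qE]]] := hq.
have q_gt1 : (1 < q)%N by rewrite qE -(exp1n e) ltn_exp2r // prime_gt1.
have q_gt0 := ltnW q_gt1.
have pchar_q : [pchar F].-nat q.
  rewrite qE pnatX pnatE // (@card_finPcharP F p (e * r.+1)%N) //.
  by rewrite cardF qE expnM.
have N_gt0 : (0 < q ^ r)%N by rewrite expn_gt0 q_gt0.
have cardF_gt0 : (0 < q ^ r.+1)%N by rewrite expn_gt0 q_gt0.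
(* [k] is the cofactor of [u] in (|F| - 1)/(q - 1). *)
have [k cardFk] : exists k, #|F| = (A * k).+1.
  have [k kE] := dvdnP u_dvd; exists k.
  have : (q - 1 %| q ^ r.+1 - 1)%N by rewrite !subn1 dvdn_pred_predX.
  move/divnK; rewrite kE cardF /A => dE.
  by rewrite mulnAC -mulnA mulnC dE subn1 prednK.
(* |F| is zero in F and equals (q-1)uk + 1, so u = 0 would give 1 = 0. *)
have u_neq0 : u%:R != 0 :> F.
  have : (#|F|)%:R = 0 :> F by rewrite cardF natrX pchar_natr_eq0 // expr0n.
  move=> /eqP; apply: contraL => /eqP u0.
  by rewrite cardFk -natr1 /A !natrM u0 mulr0 mul0r add0r oner_neq0.
have beta_neq0 i : norm_trace_beta u P 0 i != 0.
  by rewrite mxE; case: ifP; rewrite ?invr_eq0 ?oner_neq0.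
have DeltaE m : Delta A.+1 (q ^ r) m <-> (m <= xymon A (q ^ r).-1)%MM.
  by rewrite -Delta_le prednK.
have -> : Delta A.+1 (q ^ r) = [set m | (m <= xymon A (q ^ r).-1)%MM]%classic.
  by apply/seteqP; split=> m /DeltaE.
have pairing m l : monomial_pairing P (norm_trace_beta u P) m l =
    \sum_(i < n) norm_trace_beta u P 0 i * ((tnth P i).1 ^+ (m ord0 + l ord0) *
                                            (tnth P i).2 ^+ (m ord_max + l ord_max)).
  apply: eq_bigr => i _; rewrite !ev_monomial !exprD; congr (_ * _); ring.
have dualE : dual_code (ev_code P M) = scale_code (norm_trace_beta u P)
    (ev_code P [set (xymon A (q ^ r).-1 - m)%MM |
       m in [set m | (m <= xymon A (q ^ r).-1)%MM] `\` M]%classic).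
  apply: dual_ev_code => //.
  - by move=> m /M_sub /DeltaE.
  - move=> m l; rewrite !le_xymon => /andP[m0 m1] /andP[l0 l1] lm.
    rewrite pairing !mnmBE xymon0 xymon1.
    (* If [l] has the larger y-exponent, the combined y-exponent falls below q^r - 1. Otherwise, as
       [l] does not divide [m], its x-exponent is the larger one and the combined x-exponent falls
       below [A]. *)
    have [l1m | m1l] := leqP (l ord_max) (m ord_max); last first.
      by rewrite (pairing_low pchar_q q_gt1 hu0 cardF cardFk hPuniq PE) //; lia.
    have m0l : (m ord0 < l ord0)%N.
      rewrite ltnNge; apply: contra lm => l0m; apply/mnm_lepP => i.
      by have [->|->] := ord2_cases i.
    rewrite (pairing_high pchar_q q_gt1 hu0 cardF cardFk hPuniq PE) -/A; try lia.
    by rewrite ltn_eqF ?oppr0 ?mul0r //; lia.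
  - move=> m; rewrite le_xymon => /andP[m0 m1]; rewrite pairing !mnmBE xymon0 xymon1.
    rewrite !subnKC // (pairing_top pchar_q q_gt1 hu0 cardF cardFk hPuniq PE).
    by rewrite oppr_eq0 oner_neq0.
  - exact: (ev_surjective pchar_q q_gt1 hu0 u_neq0 cardF cardFk hPuniq PE).
split; last exact: dualE.
(* Equivalence asks for the second code as a multiple of the dual, hence the inverse of beta. *)
exists (\row_i (norm_trace_beta u P 0 i)^-1); split=> [i|].
  by rewrite mxE invr_eq0.
have scaleK (c : 'rV[F]_n) : \row_i ((\row_j (norm_trace_beta u P 0 j)^-1) 0 i *
    (\row_j (norm_trace_beta u P 0 j * c 0 j)) 0 i) = c.
  by apply/rowP => i; rewrite mxE [X in X * _]mxE [X in _ * X]mxE mulKf.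
rewrite dualE; apply/seteqP; split=> [c Cc | _ [_ [c Cc <-] <-]].
  by exists (\row_i (norm_trace_beta u P 0 i * c 0 i)); first by exists c.
by rewrite scaleK.
Qed.
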